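(* Let $\mathcal T$ be a subsequential, complete, strongly connected, aperiodic transducer. Then the asymptotic variance $v_2$ of the output sum is zero if and only if the output sum is quasi-deterministic.
   Context: A transducer consists of a finite set of states $\{1,\dots,S\}$, a finite input alphabet $\mathcal A_I\subseteq\mathbb R$ (with at least two elements), an output alphabet $\mathcal A_O\subseteq\mathbb R$, a set of transitions $\mathcal E\subseteq\{1,\dots,S\}^2\times\mathcal A_I$, output labels $\delta\colon\mathcal E\to\mathcal A_O$, and the initial state $1$. A transition $e=(s,t,\varepsilon)$ goes from $s$ to $t$ and has input label $\varepsilon$ and output label $\delta(e)$. The underlying graph is the directed multigraph (loops and parallel edges allowed) whose vertices are the states and whose edges are the transitions. The transducer is deterministic if for every state $s$ and $\varepsilon\in\mathcal A_I$ there is at most one $t$ with $(s,t,\varepsilon)\in\mathcal E$; complete if for every $s$ and $\varepsilon$ there is some such $t$; subsequential if it is deterministic, every state is final, and it has a final output $a\colon\{1,\dots,S\}\to\mathcal A_O$. It is strongly connected and aperiodic if its underlying graph is strongly connected and the gcd of the lengths of all closed walks starting and ending at a given vertex is $1$. The output of the transducer on an input word is the sequence of output labels along the unique path starting at state $1$ whose input labels are the word (read in a fixed direction, from right to left), together with the final output label of the last state of this path. $X_n$ is uniformly distributed on $\mathcal A_I^n$ and $\mathsf{Output}(X_n)$ is the sum of its output sequence. There is a constant $v_2$ with $\mathbb V(\mathsf{Output}(X_n))=v_2n+\mathcal O(1)$; it is called the asymptotic variance of the output sum. The output sum is quasi-deterministic if there is a constant $k\in\mathbb R$ such that $\mathsf{Output}(X_n)=kn+\mathcal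 O(1)$ holds for all $n$ and all inputs, i.e. the difference $\mathsf{Output}(w)-kn$ is bounded uniformly over all $n$ and all words $w\in\mathcal A_I^n$. *)

(* Defs.v *)
From mathcomp Require Import all_boot all_order all_algebra.
From mathcomp Require Import finmap.
From mathcomp Require Import all_classical all_reals all_analysis.
Set Implicit Arguments.
Unset Strict Implicit.
Unset Printing Implicit Defensive.
Import Order.TTheory GRing.Theory Num.Theory numFieldNormedType.Exports.
Local Open Scope classical_set_scope.
Local Open Scope ring_scope.

(* The number of states is [npred.+1], so that the initial state, numbered 1
   on paper and [ord0] here, exists.  Only the values of [outlabel] on members
   of [trans] are meaningful. *)
Record transducer (R : realType) := Transducer {
  npred : nat;
  inalph : {fset R};
  inalph_gt1 : (1 < #|` inalph|)%N;
  outalph : set R;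
  trans : {set 'I_npred.+1 * 'I_npred.+1 * inalph};
  outlabel : 'I_npred.+1 * 'I_npred.+1 * inalph -> R;
  outlabelP : forall e, e \in trans -> outalph (outlabel e);
  final : {set 'I_npred.+1}
}.

Notation state T := ('I_(npred T).+1).
Notation letter T := (fset_sub_type (inalph T)).
Notation transition T := (state T * state T * letter T)%type.

Section Graph.
Variables (R : realType) (T : transducer R).

Definition source (e : transition T) : state T := e.1.1.
Definition target (e : transition T) : state T := e.1.2.
Definition label (e : transition T) : letter T := e.2.

Definition endpoint (s : state T) (p : seq (transition T)) : state T :=
  last s (map target p).

Fixpoint walk (s : state T) (p : seq (transition T)) : bool :=
  if p is e :: q then [&& e \in trans T, source e == s & walk (target e) q]
  else true.

Definition deterministic : Prop :=
  forall (s : state T) (x : letter T) (t t' : state T),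
    (s, t, x) \in trans T -> (s, t', x) \in trans T -> t = t'.

Definition complete : Prop :=
  forall (s : state T) (x : letter T), exists t : state T,
    (s, t, x) \in trans T.

Definition subsequential (a : state T -> R) : Prop :=
  [/\ deterministic, final T = [set: state T]%SET
    & forall s, outalph T (a s)].

Definition strongly_connected : Prop :=
  forall s t : state T, exists p, walk s p /\ endpoint s p = t.

Definition is_gcd (A : set nat) (g : nat) : Prop :=
  (forall m, A m -> (g %| m)%N) /\
  (forall d, (forall m, A m -> (d %| m)%N) -> (d %| g)%N).

Definition aperiodic : Prop :=
  forall s : state T,
    is_gcd [set size p | p in [set p | walk s p /\ endpoint s p = s]] 1.

End Graph.

Arguments subsequential {R} T a.

Section Output.
Variables (R : realType) (T : transducer R) (a : state T -> R).

(* The path read along [w]: [rev] because input is read from right to left.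
   Such a path exists and is unique if [T] is complete and deterministic
   ([path_unique], [path_ofP]); the
   default value [[::]] is then never used. *)
Definition path_of (w : seq (letter T)) : seq (transition T) :=
  xget [::] [set p | walk ord0 p /\ map (@label R T) p = rev w].

Definition output_seq (w : seq (letter T)) : seq R :=
  rcons (map (@outlabel R T) (path_of w)) (a (endpoint ord0 (path_of w))).

Definition Output (w : seq (letter T)) : R := \sum_(y <- output_seq w) y.

Definition unif_expectation (n : nat) (f : n.-tuple (letter T) -> R) : R :=
  (\sum_(w : n.-tuple (letter T)) f w) / #|{: n.-tuple (letter T)}|%:R.

Definition unif_variance (n : nat) (f : n.-tuple (letter T) -> R) : R :=
  unif_expectation (fun w => (f w - unif_expectation f) ^+ 2).

(* [v2] is determined by this property: see [asymptotic_variance_unique]. *)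
Definition is_asymptotic_variance (v2 : R) : Prop :=
  exists C : R, forall n : nat,
    `|unif_variance (fun w : n.-tuple (letter T) => Output w) - v2 * n%:R|
      <= C.

Definition quasi_deterministic : Prop :=
  exists k C : R, forall (n : nat) (w : n.-tuple (letter T)),
    `|Output w - k * n%:R| <= C.

End Output.

Arguments Output {R} T a w.
Arguments is_asymptotic_variance {R} T a v2.
Arguments quasi_deterministic {R} T a.

Lemma asymptotic_variance_unique (R : realType) (T : transducer R)
    (a : state T -> R) (v v' : R) :
  is_asymptotic_variance T a v -> is_asymptotic_variance T a v' -> v = v'.
Proof.
move=> [C hC] [C' hC']; apply/eqP; rewrite -subr_eq0; apply/negPn/negP => vv'.
have b n : `|v - v'| * n%:R <= C + C'.
  rewrite -[X in _ * X]ger0_norm ?ler0n// -normrM.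
  set V := unif_variance (fun w : n.-tuple (letter T) => Output T a w).
  have -> : (v - v') * n%:R = - (V - v * n%:R) + (V - v' * n%:R).
    by rewrite opprB mulrBl addrA subrK.
  apply: le_trans (ler_normD _ _) _.
  by rewrite normrN lerD ?hC ?hC'.
have p : 0 < `|v - v'| by rewrite normr_gt0.
have := b (Num.bound (Num.norm ((C + C') / `|v - v'|))).
rewrite mulrC -ler_pdivlMr// leNgt => /negP; apply.
by rewrite (le_lt_trans (ler_norm _))// archi_boundP// normr_ge0.
Qed.

Lemma path_unique (R : realType) (T : transducer R) :
  deterministic T -> complete T ->
  forall (v : seq (letter T)) (s : state T),
    exists! p, walk s p /\ map (@label R T) p = v.
Proof.
move=> det com; elim=> [|x v IHv] s.
  by exists [::]; split=> // -[|e p] [].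
have [t st] := com s x.
have [p [[wp lp] up]] := IHv t.
exists ((s, t, x) :: p); split.
  by split; rewrite /= ?st ?eqxx ?lp.
move=> [|[[s' t'] y] q] [] //= /and3P[e_in /eqP ss' wq] [yx lq].
rewrite /source/= in ss'; rewrite /label/= in yx; subst s' y.
have tt' := det _ _ _ _ st e_in; subst t'.
by rewrite (up q).
Qed.

Lemma path_ofP (R : realType) (T : transducer R) :
  deterministic T -> complete T -> forall w : seq (letter T),
    walk ord0 (path_of w) /\ map (@label R T) (path_of w) = rev w.
Proof.
move=> det com w; have [p [hp _]] := path_unique det com (rev w) ord0.
exact: (@xgetPex _ [::] [set p | walk ord0 p /\ map (@label R T) p = rev w]
  (ex_intro _ p hp)).
Qed.

(* Main.v *)
(** If the input is read from an arbitrary state [s], a block of [B] letters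
    splits the variance of the output of [B + n] letters into the mean of the
    variances for [n] letters from the states reached, plus the variance of a
    function of the block alone.  If two closed walks of equal length at the
    initial state had different outputs, then (going first to the initial state,
    then along either of them, then padding) from each [s] there would be two
    blocks of a common length [B], with the same final state and with outputs at
    a fixed nonzero difference.  The second term would be bounded below by a
    positive constant, and the variance would be unbounded.  So if [v2 = 0], all
    closed walks at the initial state have the same mean output [k] per letter,
    and every walk from there is completed to a closed one at bounded cost. *)
Require Import Defs.
From mathcomp Require Import all_boot all_order all_algebra.
From mathcomp Require Import finmap.
From mathcomp Require Import all_classical all_reals all_analysis.
From mathcomp Require Import ring lra.
Set Implicit Arguments.
Unset Strict Implicit.
Unset Printing Implicit Defensive.
Import Order.TTheory GRing.Theory Num.Theory.
Local Open Scope ring_scope.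

(** * Mean and variance over uniformly random words *)

Section UniformExpectation.
Variables (R : realType) (T : transducer R).

Local Notation E n F :=
  (unif_expectation (fun w : n.-tuple (letter T) => F (w : seq (letter T)))).

Lemma letter_inhabited : exists x : letter T, x \in letter T.
Proof. by apply/card_gt0P; rewrite -cardfE (ltnW (inalph_gt1 T)). Qed.

Lemma card_words_gt0 n : 0 < #|{: n.-tuple (letter T)}|%:R :> R.
Proof.
by rewrite ltr0n card_tuple expn_gt0 -cardfE (ltnW (inalph_gt1 T)).
Qed.

Lemma unif_expectationD n (f g : n.-tuple (letter T) -> R) :
  unif_expectation (fun w => f w + g w)
  = unif_expectation f + unif_expectation g.
Proof. by rewrite /unif_expectation big_split mulrDl. Qed.

Lemma unif_expectationZ n c (f : n.-tuple (letter T) -> R) :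
  unif_expectation (fun w => c * f w) = c * unif_expectation f.
Proof. by rewrite /unif_expectation -mulr_sumr mulrA. Qed.

Lemma unif_expectation_cst n (c : R) :
  unif_expectation (fun _ : n.-tuple (letter T) => c) = c.
Proof.
rewrite /unif_expectation sumr_const -[c *+ _]mulr_natr mulfK//.
by rewrite gt_eqF ?card_words_gt0.
Qed.

Lemma unif_expectation_le n (f g : n.-tuple (letter T) -> R) :
  (forall w, f w <= g w) -> unif_expectation f <= unif_expectation g.
Proof.
move=> fg; rewrite ler_pM2r ?invr_gt0 ?card_words_gt0//.
by apply: ler_sum => w _; exact: fg.
Qed.

Lemma eq_unif_expectation n (f g : n.-tuple (letter T) -> R) :
  f =1 g -> unif_expectation f = unif_expectation g.
Proof. by move=> fg; rewrite /unif_expectation (eq_bigr g). Qed.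

Lemma unif_expectation_ge_point n (f : n.-tuple (letter T) -> R) w :
  (forall v, 0 <= f v) ->
  f w / #|{: n.-tuple (letter T)}|%:R <= unif_expectation f.
Proof.
move=> f0; rewrite ler_pM2r ?invr_gt0 ?card_words_gt0//.
by rewrite (bigD1 w)//= lerDl sumr_ge0.
Qed.

Lemma unif_expectation_rev n (F : seq (letter T) -> R) :
  E n (fun w => F (rev w)) = E n F.
Proof.
rewrite /unif_expectation; congr (_ / _).
rewrite [RHS](reindex_inj (h := fun w : n.-tuple _ => rev_tuple w))//=.
by move=> u v /(congr1 val)/= /(can_inj revK)/val_inj.
Qed.

Lemma unif_expectation_cat m n (F : seq (letter T) -> R) :
  E (m + n) F = E m (fun u => E n (fun v => F (u ++ v))).
Proof.
rewrite /unif_expectation -mulr_suml -mulrA -invfM -natrM.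
congr (_ / _%:R); last by rewrite !card_tuple expnD mulnC.
rewrite pair_big/=.
pose cat2 (p : m.-tuple (letter T) * n.-tuple (letter T)) := cat_tuple p.1 p.2.
rewrite (reindex cat2)//=; apply: onW_bij; apply: inj_card_bij.
  move=> [u v] [u' v'] /(congr1 val)/= /eqP.
  by rewrite eqseq_cat ?size_tuple// => /andP[/eqP/val_inj-> /eqP/val_inj->].
by rewrite card_prod !card_tuple expnD.
Qed.

(** Bias-variance decomposition: the cross term vanishes because [f] minus its mean has mean
    zero. *)
Lemma unif_expectation_sqrB n (f : n.-tuple (letter T) -> R) c :
  unif_expectation (fun w => (f w - c) ^+ 2)
  = unif_variance f + (unif_expectation f - c) ^+ 2.
Proof.
rewrite /unif_variance; set m := unif_expectation f.
have -> : unif_expectation (fun w => (f w - c) ^+ 2)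
    = unif_expectation (fun w => (f w - m) ^+ 2
        + ((2 * (m - c)) * f w + ((m - c) ^+ 2 - 2 * (m - c) * m))).
  by apply: eq_unif_expectation => w; ring.
rewrite unif_expectationD unif_expectationD unif_expectationZ.
rewrite unif_expectation_cst -/m; ring.
Qed.

Lemma unif_variance_rev n (F : seq (letter T) -> R) :
  unif_variance (fun w : n.-tuple (letter T) => F (rev w))
  = unif_variance (fun w : n.-tuple (letter T) => F w).
Proof.
rewrite /unif_variance unif_expectation_rev.
exact: (unif_expectation_rev n (fun w => (F w - _) ^+ 2)).
Qed.

Lemma unif_variance_ge0 n (f : n.-tuple (letter T) -> R) :
  0 <= unif_variance f.
Proof.
rewrite -(unif_expectation_cst n 0); apply: unif_expectation_le => w.
exact: sqr_ge0.
Qed.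

(* One of two numbers at distance [d] is at distance [>= d / 2] from [c]. *)
Lemma unif_expectation_sqr_ge n (f : n.-tuple (letter T) -> R) u v c d :
  f v - f u = d ->
  d ^+ 2 / 4 / #|{: n.-tuple (letter T)}|%:R
  <= unif_expectation (fun w => (f w - c) ^+ 2).
Proof.
move=> fuv.
have [w dw] : exists w, d ^+ 2 / 4 <= (f w - c) ^+ 2.
  have [|lt] := lerP (d ^+ 2 / 4) ((f u - c) ^+ 2); first by exists u.
  exists v; rewrite -fuv in lt *.
  have := sqr_ge0 (f u - c + (f v - c)); nra.
apply: le_trans (unif_expectation_ge_point w _) => [|z]; last exact: sqr_ge0.
by rewrite ler_pM2r ?invr_gt0 ?card_words_gt0.
Qed.

End UniformExpectation.

(** * Runs of a total transition function from arbitrary states *)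

Section Run.
Variables (R : realType) (T : transducer R) (a : state T -> R).
Variable step : state T -> letter T -> state T.

(** Words are read from left to right here, and the final output is left out so that outputs add up
    along concatenations. *)
Fixpoint run_output (s : state T) (w : seq (letter T)) : R :=
  if w is x :: v then outlabel (s, step s x, x) + run_output (step s x) v
  else 0.

Definition run_total s w := run_output s w + a (foldl step s w).

Lemma run_output_cat s u v :
  run_output s (u ++ v) = run_output s u + run_output (foldl step s u) v.
Proof. by elim: u s => [|x u IH] s /=; rewrite ?add0r// IH addrA. Qed.

Lemma run_total_cat s u v :
  run_total s (u ++ v) = run_output s u + run_total (foldl step s u) v.
Proof. by rewrite /run_total run_output_cat foldl_cat addrA. Qed.

Definition power n (w : seq (letter T)) := flatten (nseq n w).

Lemma size_power n w : size (power n w) = (n * size w)%N.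
Proof. by elim: n => //= n IH; rewrite size_cat mulSn -IH. Qed.

Lemma run_power s n w : foldl step s w = s ->
  foldl step s (power n w) = s /\
  run_output s (power n w) = run_output s w *+ n.
Proof.
move=> sw; elim: n => [|n [IH1 IH2]]//=.
by rewrite foldl_cat run_output_cat sw IH1 IH2 mulrS.
Qed.

Local Notation V n s :=
  (unif_variance (fun w : n.-tuple (letter T) => run_total s w)).

Lemma variance_block m n s (c d : R) (u v : m.-tuple (letter T)) :
  (forall t, c <= V n t) ->
  foldl step s u = foldl step s v ->
  run_output s v - run_output s u = d ->
  c + d ^+ 2 / 4 / #|{: m.-tuple (letter T)}|%:R <= V (m + n)%N s.
Proof.
move=> cV uv duv.
rewrite /(V (m + n)%N s).
set M := unif_expectation (fun w : (m + n).-tuple (letter T) => run_total s w).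
rewrite (unif_expectation_cat m n (fun w => (run_total s w - M) ^+ 2)).
(* [f w] is the conditional mean of the total, given the first block [w]. *)
pose f (w : m.-tuple (letter T)) := run_output s w
  + unif_expectation (fun z : n.-tuple (letter T) =>
      run_total (foldl step s w) z).
apply: (@le_trans _ _ (unif_expectation (fun w : m.-tuple (letter T) =>
    c + (f w - M) ^+ 2))).
  rewrite unif_expectationD unif_expectation_cst lerD2l.
  apply: (unif_expectation_sqr_ge (u := u) (v := v)).
  (* As [u] and [v] lead to the same state, the mean contributions of the remaining letters cancel
     in [f v - f u]. *)
  by rewrite -duv /f uv; ring.
apply: unif_expectation_le => w.
have -> : unif_expectation (fun z : n.-tuple (letter T) =>
      (run_total s (w ++ z) - M) ^+ 2)
    = unif_expectation (fun z : n.-tuple (letter T) =>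
      (run_total (foldl step s w) z - (M - run_output s w)) ^+ 2).
  apply: eq_unif_expectation => z.
  by rewrite run_total_cat; congr (_ ^+ 2); ring.
rewrite unif_expectation_sqrB lerD//.
by rewrite /f opprB addrA [X in (X - M) ^+ 2 <= _]addrC.
Qed.

Lemma variance_blocks m (d : R) :
  (forall s, exists u v : m.-tuple (letter T),
    foldl step s u = foldl step s v /\ run_output s v - run_output s u = d) ->
  forall n s, (d ^+ 2 / 4 / #|{: m.-tuple (letter T)}|%:R) * n%:R
              <= V (n * m)%N s.
Proof.
move=> huv; elim=> [|n IH] s; first by rewrite mulr0 unif_variance_ge0.
have [u [v [uv duv]]] := huv s.
by rewrite -[n.+1%:R]natr1 mulrDr mulr1; exact: (variance_block IH uv duv).
Qed.

Hypothesis reach : forall s t, exists w, foldl step s w = t.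

Lemma synchronized_blocks u v :
  size u = size v -> foldl step ord0 u = ord0 -> foldl step ord0 v = ord0 ->
  exists m, forall s, exists u' v' : m.-tuple (letter T),
    foldl step s u' = foldl step s v' /\
    run_output s v' - run_output s u' = run_output ord0 v - run_output ord0 u.
Proof.
move=> suv u0 v0.
have [ret retP] := choice (fun s => reach s ord0).
have [x _] := letter_inhabited T.
(* This bounds all return words at once, so that padding gives every block the length [N + size u],
   whatever the state [s]. The padding is read from [ord0] in both blocks and cancels. *)
pose N := (\max_s size (ret s))%N.
exists (N + size u)%N => s.
pose pad := nseq (N - size (ret s)) x.
have sz z : size z = size u -> size (ret s ++ z ++ pad) == (N + size u)%N.
  move=> zu; rewrite !size_cat size_nseq zu addnCA subnKC ?[(_ + N)%N]addnC//.
  exact: (leq_bigmax s).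
exists (Tuple (sz u erefl)), (Tuple (sz v (esym suv))) => /=.
rewrite !foldl_cat !run_output_cat !retP u0 v0; split=> //; ring.
Qed.

Lemma closed_output_unique C :
  (forall n, V n ord0 <= C) ->
  forall u v, size u = size v ->
  foldl step ord0 u = ord0 -> foldl step ord0 v = ord0 ->
  run_output ord0 u = run_output ord0 v.
Proof.
move=> VC u v suv u0 v0; apply/esym/eqP; rewrite -subr_eq0.
apply/negPn/negP => d0.
have [m /variance_blocks lb] := synchronized_blocks suv u0 v0.
move: lb; set c := _ / _ / _ => lb.
have c0 : 0 < c.
  by rewrite !divr_gt0 ?card_words_gt0// exprn_even_gt0.
(* By the Archimedean property, this number of blocks exceeds [C / c]. *)
have := le_trans (lb (Num.bound (Num.norm (C / c))) ord0) (VC _).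
rewrite mulrC -ler_pdivlMr// leNgt => /negP; apply.
exact: le_lt_trans (ler_norm _) (archi_boundP (normr_ge0 _)).
Qed.

Lemma bounded_variance_linear C :
  (forall n, V n ord0 <= C) ->
  exists k D, forall w, `|run_total ord0 w - k * (size w)%:R| <= D.
Proof.
move=> /closed_output_unique closedP.
have [ret retP] := choice (fun s => reach s ord0).
have [x _] := letter_inhabited T.
(* The leading letter keeps this closed walk nonempty, so that [k] divides by a positive length. *)
pose c := x :: ret (step ord0 x).
have c0 : foldl step ord0 c = ord0 by rewrite /= retP.
pose k := run_output ord0 c / (size c)%:R.
have closed_lin w : foldl step ord0 w = ord0 ->
    run_output ord0 w = k * (size w)%:R.
  move=> w0.
  (* Repeating [w] as often as [c] has letters, and [c] as often as [w] has letters, gives closed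
     walks of equal length, hence of equal output. *)
  have [pw ow] := run_power (size c) w0.
  have [pc oc] := run_power (size w) c0.
  have := closedP _ _ _ pw pc; rewrite !size_power mulnC => /(_ erefl).
  rewrite ow oc -[LHS]mulr_natr -[RHS]mulr_natr => e.
  by rewrite /k mulrAC -e mulfK// pnatr_eq0.
pose D t := `|k * (size (ret t))%:R| + `|run_output t (ret t)| + `|a t|.
(* The sum over all states dominates the cost [D t] of closing up from whichever state [t] is
   reached. *)
exists k, (\sum_t D t) => w; set t := foldl step ord0 w.
have le_D : D t <= \sum_t D t.
  by rewrite (bigD1 t)//= lerDl sumr_ge0// => i _; rewrite !addr_ge0.
apply: le_trans le_D; rewrite /run_total -/t.
have := closed_lin (w ++ ret t); rewrite foldl_cat retP => /(_ erefl).
rewrite run_output_cat size_cat natrD -/t => e.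
have -> : run_output ord0 w + a t - k * (size w)%:R
    = k * (size (ret t))%:R - run_output t (ret t) + a t.
  by rewrite -[run_output ord0 w](addrK (run_output t (ret t))) e; ring.
by rewrite (le_trans (ler_normD _ _))// lerD2r ler_normB.
Qed.

End Run.

(** * Walks of the transducer as runs *)

Section Walk.
Variables (R : realType) (T : transducer R) (a : state T -> R).
Variable step : state T -> letter T -> state T.
Hypothesis det : deterministic T.
Hypothesis stepP : forall s x, (s, step s x, x) \in trans T.

(** Determinism forces each transition of a walk to be the one selected by [step]. *)
Lemma walk_run s p : walk s p ->
  endpoint s p = foldl step s (map (@label R T) p) /\
  \sum_(e <- p) outlabel e = run_output step s (map (@label R T) p).
Proof.
elim: p s => [|[[s' t] x] p IH] s /=; first by rewrite big_nil.
rewrite {1}/source/= => /and3P[e_in /eqP ss']; subst s'.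
have -> : step s x = t by apply: det e_in; exact: stepP.
by rewrite big_cons /target/= => /IH[<- <-].
Qed.

Lemma Output_run (hcomp : complete T) w :
  Output T a w = run_total a step ord0 (rev w).
Proof.
have [wp lp] := path_ofP det hcomp w.
have [ep op] := walk_run wp; rewrite lp in ep op.
by rewrite /Output /output_seq -cats1 big_cat big_map big_seq1 ep op.
Qed.

End Walk.

(** The variance is at most the second moment about any point, here [k * n%:R]. *)
Lemma quasi_deterministic_variance (R : realType) (T : transducer R)
    (a : state T -> R) :
  quasi_deterministic T a -> is_asymptotic_variance T a 0.
Proof.
move=> [k [C hC]]; exists (C ^+ 2) => n.
rewrite mul0r subr0 ger0_norm ?unif_variance_ge0//.
apply: (@le_trans _ _ (unif_expectation (fun w : n.-tuple (letter T) =>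
    (Output T a w - k * n%:R) ^+ 2))).
  by rewrite unif_expectation_sqrB lerDl sqr_ge0.
rewrite -(unif_expectation_cst T n (C ^+ 2)).
apply: unif_expectation_le => w; rewrite -real_normK ?num_real//.
by rewrite lerXn2r ?nnegrE// (le_trans _ (hC _ w)).
Qed.

Theorem corollary3p4 (R : realType) (T : transducer R) (a : state T -> R)
    (hsub : subsequential T a) (hcomp : complete T)
    (hconn : strongly_connected T) (haper : aperiodic T)
    (v2 : R) (hv2 : is_asymptotic_variance T a v2) :
  v2 = 0%R <-> quasi_deterministic T a.
Proof.
split=> [v0|/quasi_deterministic_variance]; last first.
  exact: asymptotic_variance_unique.
have [det _ _] := hsub.
have [step stepP] : exists step : state T -> letter T -> state T,
    forall s x, (s, step s x, x) \in trans T.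
  by exists (fun s => projT1 (choice (hcomp s))) => s x;
     exact: (projT2 (choice (hcomp s))).
have reach s t : exists w, foldl step s w = t.
  have [p [wp <-]] := hconn s t.
  by exists (map (@label R T) p); have [] := walk_run det stepP wp.
have [C hC] := hv2.
(* Reversal preserves the uniform distribution, so left-to-right runs have the same variance as
   [Output]. *)
have VC n : unif_variance (fun w : n.-tuple (letter T) =>
    run_total a step ord0 w) <= C.
  have := hC n; rewrite v0 mul0r subr0.
  rewrite -(unif_variance_rev _ (run_total a step ord0)).
  rewrite (_ : (fun w : n.-tuple _ => Output T a w)
      = fun w => run_total a step ord0 (rev w)).
    exact: le_trans (ler_norm _).
  by apply/funext => w; exact: Output_run.
have [k [D kD]] := bounded_variance_linear reach VC.
exists k, D => n w; rewrite (Output_run a det stepP)//.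
by have := kD (rev w); rewrite size_rev size_tuple.
Qed.
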